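(* Let $S_n$ be the star graph of order $n\geq 3$ with vertex set $\{v_1,\ldots,v_n\}$, where $v_1\in V(S_n)$ satisfies $\deg(v_1)=n-1$, and let $\mathcal{H}=(H^1,H^2,\ldots,H^n)$ be a sequence of graphs each of which is a star graph or a complete graph. Then $$\dim_{\mathrm{diam}}(S_n\odot\mathcal{H})=|D(S_n\odot\mathcal{H})|+\dim(H^1).$$
   Context: Distances are shortest-path distances: $d_G(u,v)$ is the length of a shortest $u$–$v$ path in the connected graph $G$. The eccentricity of $v$ is $e_G(v)=\max_{u\in V(G)}d_G(u,v)$ and $\operatorname{diam}(G)=\max_v e_G(v)$. A vertex is diametral if its eccentricity equals $\operatorname{diam}(G)$; the diametral set $D(G)$ is the set of all diametral vertices of $G$. For an ordered set $W=\{w_1,\ldots,w_k\}\subseteq V(G)$, the representation of $v$ is $r(v\mid W)=(d_G(v,w_1),\ldots,d_G(v,w_k))$. $W$ is a resolving set of $G$ if $r(u\mid W)\neq r(v\mid W)$ for all distinct $u,v\in V(G)$. The metric dimension $\dim(G)$ is the minimum cardinality of a resolving set of $G$. A diametral resolving set is a resolving set $W$ with $D(G)\subseteq W$; the diametral metric dimension $\dim_{\mathrm{diam}}(G)$ is the minimum cardinality of a diametral resolving set of $G$. Generalized corona: for a graph $G$ with $V(G)=\{v_1,\ldots,v_n\}$ and a sequence of graphs $\mathcal{H}=(H^1,\ldots,H^n)$, $G\odot\mathcal{H}$ is the graph obtained by taking one copy of $G$ and one (disjoint) copy of each $H^i$, and joining the vertex $v_i$ of $G$ to every vertex of the copy of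 $H^i$, for each $i=1,\ldots,n$. $S_m$ denotes the star graph of order $m$ (one center adjacent to $m-1$ leaves) and $K_q$ the complete graph of order $q$. *)

(* Defs.v *)
From mathcomp Require Import all_boot.

Set Implicit Arguments.
Unset Strict Implicit.
Unset Printing Implicit Defensive.

Record sgraph := SGraph {
  vertex :> finType;
  adj : rel vertex;
  adj_sym : symmetric adj;
  adj_irrefl : irreflexive adj }.

Section Metric.
Variable G : sgraph.
Implicit Types (u v : G) (W : {set G}).

Definition deg v : nat := #|[set u | adj v u]|.

Definition has_path_of_length u v (k : nat) : bool :=
  [exists p : k.-tuple G,
     [&& path (@adj G) u p, last u p == v & uniq (u :: p)]].

(* The least k < #|G| such that there is a u-v path of length k. If u and v lie
   in different components, the value is #|G|, which is never a distance. *)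
Definition dist u v : nat := find (has_path_of_length u v) (iota 0 #|G|).

Definition ecc v : nat := \max_(u : G) dist u v.

Definition diam : nat := \max_(v : G) ecc v.

Definition diametral_set : {set G} := [set v | ecc v == diam].

(* W is ordered by the enumeration of G; resolvability does not depend on the
   order chosen. *)
Definition representation v W : seq nat := [seq dist v w | w <- enum W].

Definition resolving W : bool :=
  [forall u, forall v, (u != v) ==> (representation u W != representation v W)].

Definition diametral_resolving W : bool :=
  resolving W && (diametral_set \subset W).

Lemma dist_eq0 u v : (dist u v == 0) = (u == v).
Proof.
rewrite /dist; have : 0 < #|G| by apply/card_gt0P; exists u.
case: #|G| => // n _ /=.
suff -> : has_path_of_length u v 0 = (u == v) by case: (u == v).
apply/existsP/idP => [[p]|uv].
  by rewrite (tuple0 p) /= andbT.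
by exists [tuple]; rewrite /= andbT.
Qed.

Lemma resolvingT : resolving setT.
Proof.
apply/forallP=> u; apply/forallP=> v; apply/implyP; apply: contra => /eqP.
move/eq_in_map/(_ u); rewrite mem_enum inE => /(_ isT)/esym/eqP.
by rewrite (eqP (_ : dist u u == 0)) dist_eq0 // eq_sym.
Qed.

Lemma diametral_resolvingT : diametral_resolving setT.
Proof. by rewrite /diametral_resolving resolvingT subsetT. Qed.

(* By [resolvingT] and [diametral_resolvingT] the minima are over nonempty
   families. The empty set is allowed, so a one-vertex graph has dimension 0. *)
Definition metric_dim : nat := #|[arg min_(W < setT | resolving W) #|W|]|.

Definition diametral_dim : nat :=
  #|[arg min_(W < setT | diametral_resolving W) #|W|]|.

End Metric.

Definition is_star (G : sgraph) : Prop :=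
  exists c : G,
    (forall x : G, x != c -> adj c x) /\
    (forall x y : G, x != c -> y != c -> ~~ adj x y).

Definition is_complete (G : sgraph) : Prop :=
  0 < #|G| /\ forall x y : G, x != y -> adj x y.

Section Corona.
Variables (G : sgraph) (H : G -> sgraph).

(* [inl v] is the vertex v of G and [inr (Tagged _ x)], with x : H i, is the
   vertex x of the copy of H i attached to i. *)
Definition corona_vertex : finType := (G + {i : G & H i})%type.

Definition corona_adj : rel corona_vertex := fun a b =>
  match a, b with
  | inl u, inl v => adj u v
  | inl u, inr q => u == tag q
  | inr p, inl v => tag p == v
  | inr p, inr q => (tag p == tag q) && adj (tagged p) (tagged_as p q)
  end.

Lemma corona_adj_sym : symmetric corona_adj.
Proof.
move=> [u|[i x]] [v|[j y]] /=; rewrite 1?eq_sym //; first exact: adj_sym.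
have [eij|//] := eqVneq i j; rewrite /=; case: j / eij y => y.
by rewrite !tagged_asE adj_sym.
Qed.

Lemma corona_adj_irrefl : irreflexive corona_adj.
Proof. by case=> [u|[i x]] /=; rewrite ?eqxx ?tagged_asE ?adj_irrefl. Qed.

Definition corona : sgraph := SGraph corona_adj_sym corona_adj_irrefl.

End Corona.

(* Main.v *)
(** In the corona, two vertices of copies attached to distinct leaves of the
    star are at distance 4, and all other distances are smaller; so the diametral
    vertices are exactly those of the copies attached to the leaves.  These
    vertices separate every pair of vertices outside the copy of [H v1], and
    separate that copy from the rest, while no vertex outside the copy separates
    two vertices inside it.  Since [H v1] has diameter at most 2, its distances
    are unchanged in the corona, so exactly a resolving set of [H v1] has to be
    added to the diametral set. *)
Require Import Defs.
From mathcomp Require Import all_boot.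

Set Implicit Arguments.
Unset Strict Implicit.
Unset Printing Implicit Defensive.

(** * Distances and resolving sets in a single graph *)

Section Distance.
Variable G : sgraph.
Implicit Types (u v w x y : G) (W : {set G}).

Lemma distxx v : dist v v = 0.
Proof. by apply/eqP; rewrite dist_eq0. Qed.

(** Certifies an explicit distance formula by local checks. Since [f] drops by at most one along an
    edge, every path to [v] has length at least [f x]; since some neighbour always has a smaller
    value, descending from [x] yields a path of length exactly [f x]. *)
Lemma dist_unique v (f : G -> nat) :
    f v = 0 ->
    (forall x y, adj x y -> f x <= (f y).+1) ->
    (forall x, x != v -> exists2 y, adj x y & f y < f x) ->
  forall x, dist x v = f x.
Proof.
move=> fv0 f_lip f_desc x.
have lower p : forall y, path (@adj G) y p -> last y p = v -> f y <= size p.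
  elim: p => [|z p IHp] y /=; first by move=> _ ->; rewrite fv0.
  by case/andP=> /f_lip fyz /IHp{}IHp /IHp fz; exact: leq_trans fyz _.
(* Strictly decreasing values along the path make its vertices distinct, as [has_path_of_length]
   demands. *)
have upper k : forall y, f y = k -> exists p,
    [/\ size p = k, path (@adj G) y p, last y p = v
      & sorted gtn [seq f z | z <- y :: p]].
  elim: k => [|k IHk] y fy.
    exists [::]; split=> //=; apply/eqP; apply: contraT => /f_desc[z _].
    by rewrite fy.
  have /f_desc[z yz fzy]: y != v by apply: contra_eq_neq fy => ->; rewrite fv0.
  have fz : f z = k.
    by apply/eqP; rewrite eqn_leq -ltnS -fy fzy /= -ltnS -fy f_lip.
  have [p [sp zp lp sortp]] := IHk z fz.
  exists (z :: p); split; rewrite /= ?sp ?yz //.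
  by move: sortp; rewrite /= fzy.
(* The bound [f x < #|G|] keeps the length inside the range searched by [dist]: the path has
   [f x + 1] distinct vertices. *)
have Px : has_path_of_length x v (f x) /\ f x < #|G|.
  have [p [/eqP sp xp lp sortp]] := upper _ x erefl.
  have uniqp : uniq (x :: p).
    apply: (@map_uniq _ _ f); apply: sorted_uniq sortp.
      by move=> a b c /= ba ac; apply: ltn_trans ac ba.
    by move=> a /=; rewrite ltnn.
  split; last by rewrite -(eqP sp) -[_.+1](card_uniqP uniqp) max_card.
  by apply/existsP; exists (Tuple sp); rewrite /= xp lp eqxx.
case: Px => Px ltx; apply/eqP; rewrite eqn_leq /dist; apply/andP; split.
  rewrite leqNgt; apply/negP => /(before_find 0).
  by rewrite nth_iota // add0n Px.
have hasP : has (has_path_of_length x v) (iota 0 #|G|).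
  by apply/hasP; exists (f x); rewrite ?mem_iota.
have := nth_find 0 hasP; rewrite nth_iota; last by move: hasP; rewrite has_find size_iota.
rewrite add0n => /existsP[p /and3P[xp /eqP lp _]].
by have := lower _ _ xp lp; rewrite size_tuple.
Qed.

(** Phrased with common neighbours, so that connectedness is built in and no distance has to be
    computed. *)
Definition diameter_le2 : Prop :=
  forall u v, u != v -> ~~ adj u v -> exists2 w, adj u w & adj w v.

Definition dist2 u v : nat := if u == v then 0 else if adj u v then 1 else 2.

Lemma dist2xx v : dist2 v v = 0.
Proof. by rewrite /dist2 eqxx. Qed.

Lemma dist2_le2 u v : dist2 u v <= 2.
Proof. by rewrite /dist2; case: eqP => // _; case: ifP. Qed.

Lemma dist2_gt0 u v : (0 < dist2 u v) = (u != v).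
Proof. by rewrite /dist2; case: eqP => // _; case: ifP. Qed.

Lemma dist2C u v : dist2 u v = dist2 v u.
Proof. by rewrite /dist2 eq_sym adj_sym. Qed.

Lemma dist2_lipschitz v x y : adj x y -> dist2 x v <= (dist2 y v).+1.
Proof.
rewrite /dist2 => xy; case: eqP => // _; case: (eqVneq y v) => [<-|_].
  by rewrite xy.
by case: ifP => //; case: ifP.
Qed.

Lemma dist2_descent v x :
  diameter_le2 -> x != v -> exists2 y, adj x y & dist2 y v < dist2 x v.
Proof.
move=> diamG xv; rewrite [dist2 x v]/dist2 (negPf xv).
have [xv_adj|nxv] := boolP (adj x v); first by exists v; rewrite ?dist2xx.
have [w xw wv] := diamG x v xv nxv; exists w => //.
by rewrite /dist2 wv; case: ifP.
Qed.

Lemma dist_diameter_le2 : diameter_le2 -> forall u v, dist u v = dist2 u v.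
Proof.
move=> diamG u v; apply: (@dist_unique v (dist2^~ v)).
- exact: dist2xx.
- by move=> x y; apply: dist2_lipschitz.
- by move=> x; apply: dist2_descent.
Qed.

Lemma star_diameter_le2 : is_star G -> diameter_le2.
Proof.
case=> c [c_adj leaves] u v uv nuv.
have uc : u != c by apply: contraNneq nuv => uc; rewrite uc c_adj // -uc eq_sym.
have vc : v != c by apply: contraNneq nuv => ->; rewrite adj_sym c_adj.
by exists c; [rewrite adj_sym|]; apply: c_adj.
Qed.

Lemma complete_diameter_le2 : is_complete G -> diameter_le2.
Proof. by case=> _ G_adj u v /G_adj ->. Qed.

Lemma is_star_inhabited : is_star G -> exists x : G, true.
Proof. by case=> c _; exists c. Qed.

Lemma is_complete_inhabited : is_complete G -> exists x : G, true.
Proof. by case=> /card_gt0P[x _] _; exists x. Qed.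

Lemma resolvingP W :
  reflect (forall u v, u != v -> exists2 w, w \in W & dist u w != dist v w)
          (resolving W).
Proof.
apply: (iffP forallP) => [resW u v uv|resW u].
  have /implyP/(_ uv) := forallP (resW u) v.
  move=> neq; apply/exists_inP; apply: contraR neq => /exists_inPn eqW.
  apply/eqP/eq_in_map => w; rewrite mem_enum => /eqW.
  by rewrite negbK => /eqP.
apply/forallP=> v; apply/implyP=> /resW[w wW]; apply: contraNneq => /eq_in_map.
by move=> /(_ w); rewrite mem_enum => /(_ wW) ->.
Qed.

Lemma metric_dimP :
  exists2 W : {set G}, resolving W & #|W| = metric_dim G.
Proof.
rewrite /metric_dim; case: arg_minnP => [|W resW _]; first exact: resolvingT.
by exists W.
Qed.

Lemma metric_dim_le W : resolving W -> metric_dim G <= #|W|.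
Proof.
rewrite /metric_dim; case: arg_minnP => [|W' _ minW']; first exact: resolvingT.
exact: minW'.
Qed.

Lemma diametral_dimP :
  exists2 W : {set G}, diametral_resolving W & #|W| = diametral_dim G.
Proof.
rewrite /diametral_dim; case: arg_minnP => [|W resW _].
  exact: diametral_resolvingT.
by exists W.
Qed.

Lemma diametral_dim_le W : diametral_resolving W -> diametral_dim G <= #|W|.
Proof.
rewrite /diametral_dim; case: arg_minnP => [|W' _ minW'].
  exact: diametral_resolvingT.
exact: minW'.
Qed.

End Distance.

(** * Distances in a corona *)

Section CoronaDistance.
Variables (G : sgraph) (H : G -> sgraph).
Implicit Types (a b : corona H) (u v : G).

(** Within one copy, [dist2] is taken in the corona: two nonadjacent vertices are joined through
    their base vertex. Otherwise each endpoint lying in a copy adds one step to the distance between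
    base vertices. *)
Definition corona_dist a b : nat :=
  match a, b with
  | inl u, inl v => dist2 u v
  | inl u, inr q => (dist2 u (tag q)).+1
  | inr p, inl v => (dist2 (tag p) v).+1
  | inr p, inr q =>
      if tag p == tag q then dist2 a b
      else (dist2 (tag p) (tag q)).+2
  end.

Lemma dist_corona :
  diameter_le2 G -> forall a b, dist a b = corona_dist a b.
Proof.
move=> diamG a b; apply: (@dist_unique _ b (corona_dist^~ b)) => {a}.
- by case: b => [v|q] /=; rewrite ?eqxx dist2xx.
- case=> [u|p] [u'|p'] /=; case: b => [v|q] /=.
  + exact: dist2_lipschitz.
  + by rewrite ltnS; apply: dist2_lipschitz.
  + by move/eqP->; do 2!apply: leqW.
  + by move/eqP->; case: eqP => [->|_]; rewrite ?dist2xx //; do 2!apply: leqW.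
  + by move/eqP->.
  + by move/eqP->; case: eqP => // ->; rewrite dist2xx dist2_le2.
  + by case/andP=> /eqP tpp' _; rewrite tpp'; exact: leqnSn.
  + move=> pp'; have /andP[/eqP tpp' _] := pp'.
    by rewrite tpp'; case: ifP => // _; apply: dist2_lipschitz.
(* Descent: a base vertex moves inside [G], or straight to [q] when it is [tag q]; a copy vertex
   moves to its base vertex, unless it is adjacent to the target [q] in its own copy. *)
- case=> [u|p]; case: b => [v|q] /=.
  + move=> uv; have /(dist2_descent diamG)[y uy lt_y] : u != v by [].
    by exists (inl y).
  + have [-> _|uq _] := eqVneq u (tag q).
      by exists (inr q) => /=; rewrite eqxx ?dist2xx.
    by have [y uy lt_y] := dist2_descent diamG uq; exists (inl y).
  + by move=> _; exists (inl (tag p)) => /=.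
  + move=> pq; have [tpq|tpq] := eqVneq (tag p) (tag q); last first.
      by exists (inl (tag p)) => /=.
    rewrite [dist2 (inr p : corona H) _]/dist2 (negPf pq); case: ifP => [pq_adj|_].
      by exists (inr q) => //=; rewrite eqxx dist2xx.
    by exists (inl (tag p)) => /=; rewrite ?eqxx // tpq dist2xx.
Qed.

Definition copy (i : G) (x : H i) : corona H := inr (Tagged H x).
Arguments copy : clear implicits.

Lemma copy_inj i : injective (copy i).
Proof. by move=> x y [] /eqP; rewrite eq_Tagged => /eqP. Qed.

Lemma dist2_copy i (x y : H i) :
  dist2 (copy i x) (copy i y) = dist2 x y.
Proof. by rewrite /dist2 (inj_eq (@copy_inj i)) /= eqxx tagged_asE. Qed.

Lemma dist_copy i (x y : H i) :
  diameter_le2 G -> diameter_le2 (H i) ->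
  dist (copy i x) (copy i y) = dist x y.
Proof.
by move=> dG dH; rewrite dist_corona //= eqxx dist2_copy dist_diameter_le2.
Qed.

End CoronaDistance.

Arguments copy {G} H i x.

(** * The corona of a star with centre [c] *)

Section StarCorona.
Variables (G : sgraph) (H : G -> sgraph) (c : G).
Implicit Types (a b d : corona H) (u v : G).
Hypothesis c_adj : forall x, x != c -> adj c x.
Hypothesis leaves : forall x y : G, x != c -> y != c -> ~~ adj x y.
Hypothesis card_G : 3 <= #|G|.
Hypothesis H_inhabited : forall i, exists x : H i, true.
Hypothesis H_diameter : diameter_le2 (H c).

Let G_diameter : diameter_le2 G.
Proof. by apply: star_diameter_le2; exists c. Qed.

Definition leaf_copies : {set corona H} :=
  [set a | if a is inr p then tag p != c else false].

(** Order at least 3 provides two leaves; the second one is what makes distance 4 occur. *)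
Lemma exists_other_leaf i : exists2 j, j != c & j != i.
Proof.
have: 0 < #|~: [set c; i]|.
  have := cardsC [set c; i]; have: #|[set c; i]| <= 2 by rewrite cards2; case: eqP.
  case: #|~: _| => // le2; rewrite addn0 => E.
  by move: card_G; rewrite leqNgt ltnS -E le2.
by case/card_gt0P=> j; rewrite !inE negb_or => /andP[]; exists j.
Qed.

Lemma dist2_center j : j != c -> dist2 c j = 1.
Proof. by move=> jc; rewrite /dist2 eq_sym (negPf jc) c_adj. Qed.

Lemma dist2_center_le1 j : dist2 c j <= 1.
Proof. by have [->|/dist2_center->] := eqVneq j c; rewrite ?dist2xx. Qed.

Lemma dist2_leaves i j : i != c -> j != c -> i != j -> dist2 i j = 2.
Proof. by move=> ic jc ij; rewrite /dist2 (negPf ij) (negPf (leaves ic jc)). Qed.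

Lemma corona_dist_le4 a b : corona_dist a b <= 4.
Proof.
case: a b => [u|p] [v|q] /=; last case: ifP => _.
all: by rewrite ?ltnS ?(leq_trans (dist2_le2 _ _)).
Qed.

Lemma corona_dist_le3 a b : b \notin leaf_copies -> corona_dist a b <= 3.
Proof.
rewrite inE; case: a b => [u|p] [v|q] //=.
- by move=> _; rewrite (leq_trans (dist2_le2 _ _)).
- by move=> _; rewrite ltnS dist2_le2.
- by move=> _; rewrite ltnS dist2_le2.
- move=> /negbNE/eqP->; case: ifP => _; first by rewrite (leq_trans (dist2_le2 _ _)).
  by rewrite !ltnS dist2C dist2_center_le1.
Qed.

Lemma ecc_leaf_copies a : a \in leaf_copies -> ecc a = 4.
Proof.
move=> aD; apply/eqP; rewrite eqn_leq; apply/andP; split.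
  by apply/bigmax_leqP=> b _; rewrite dist_corona // corona_dist_le4.
move: aD; rewrite inE; case: a => // p pc.
have [j jc jp] := exists_other_leaf (tag p); have [y _] := H_inhabited j.
(* Distinct leaves are at distance 2, and each of the two copies adds 1. *)
have -> : 4 = dist (copy H j y) (inr p).
  by rewrite dist_corona //= (negPf jp) dist2_leaves.
exact: leq_bigmax.
Qed.

Lemma ecc_notin_leaf_copies a : a \notin leaf_copies -> ecc a <= 3.
Proof.
move=> aD; apply/bigmax_leqP=> b _.
by rewrite dist_corona // corona_dist_le3.
Qed.

Lemma diametral_set_corona : diametral_set (corona H) = leaf_copies.
Proof.
have [j jc _] := exists_other_leaf c; have [y _] := H_inhabited j.
have yD : copy H j y \in leaf_copies by rewrite inE.
have diam4 : diam (corona H) = 4.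
  apply/eqP; rewrite eqn_leq; apply/andP; split.
    apply/bigmax_leqP=> a _; case: (boolP (a \in leaf_copies)) => aD.
      by rewrite ecc_leaf_copies.
    exact: leqW (ecc_notin_leaf_copies aD).
  by rewrite -(ecc_leaf_copies yD) /diam leq_bigmax.
apply/setP=> a; rewrite [LHS]inE diam4.
have [/ecc_leaf_copies->//|/ecc_notin_leaf_copies] := boolP (a \in leaf_copies).
by move=> le3; apply/negbTE; rewrite neq_ltn ltnS le3.
Qed.

Lemma leaf_copies_copy (x : H c) : (copy H c x \in leaf_copies) = false.
Proof. by rewrite inE /= eqxx. Qed.

Lemma notin_leaf_copies a :
  a \notin leaf_copies -> (exists u, a = inl u) \/ exists x, a = copy H c x.
Proof.
rewrite inE; case: a => [u _|[i x] /= /negbNE/eqP/esym ci]; first by left; exists u.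
by right; case: i / ci x => x; exists x.
Qed.

(** Any path leaving the copy passes through [c], so only the base vertex enters the distance. *)
Lemma dist_copy_center_out (x y : H c) a :
  a \notin [set copy H c z | z : H c] ->
  dist (copy H c x) a = dist (copy H c y) a.
Proof.
move=> aH; rewrite !dist_corona //; case: a aH => [v|[j z]] //= aH.
have [cj|//] := eqVneq c j; case/imsetP: aH; case: j / cj z => z.
by exists z.
Qed.

(** One of the two vertices is a leaf; a vertex of its copy is at distance 1 from it and at least 2
    from the other. *)
Lemma leaf_copies_separate_base u v : u != v ->
  exists2 a, a \in leaf_copies & dist (inl u : corona H) a != dist (inl v : corona H) a.
Proof.
wlog uc : u v / u != c => [sep|] uv.
  have [uc|uc] := eqVneq u c; last exact: sep.
  have vu : v != u by rewrite eq_sym.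
  have [|a aD neq] := sep v u _ vu; first by rewrite -uc.
  by exists a; rewrite // eq_sym.
have [z _] := H_inhabited u; exists (copy H u z); first by rewrite inE.
by rewrite !dist_corona //= dist2xx eqSS eq_sym -lt0n dist2_gt0 eq_sym.
Qed.

(** Take a leaf [j] equal or adjacent to [u]: a vertex of its copy is at distance at most 2 from
    [u], but 3 from the copy at [c]. *)
Lemma leaf_copies_separate_copy u (x : H c) :
  exists2 a, a \in leaf_copies & dist (inl u : corona H) a != dist (copy H c x) a.
Proof.
have [j jc uj] : exists2 j, j != c & dist2 u j <= 1.
  have [->|uc] := eqVneq u c; last by exists u; rewrite ?dist2xx.
  have [j jc _] := exists_other_leaf c.
  by exists j; rewrite ?dist2_center.
have [z _] := H_inhabited j; exists (copy H j z); first by rewrite inE.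
rewrite !dist_corona //= (eq_sym c) (negPf jc) dist2_center // eqSS.
by rewrite neq_ltn ltnS uj.
Qed.

Lemma diametral_resolving_corona (W : {set corona H}) :
  diametral_resolving W =
  (leaf_copies \subset W) && resolving (copy H c @^-1: W).
Proof.
rewrite /diametral_resolving diametral_set_corona andbC.
have [DW|//] := boolP (leaf_copies \subset W); rewrite /=.
apply/resolvingP/resolvingP => [resW x y xy|resW a b ab].
  have [a aW] := resW _ _ (contra_neq (@copy_inj _ H c x y) xy).
  have [/imsetP[z _ a_z]|a_out] := boolP (a \in [set copy H c z | z : H c]).
    rewrite a_z !dist_copy // => dist_neq; exists z => //.
    by rewrite inE -a_z.
  by rewrite (dist_copy_center_out x y a_out) eqxx.
(* A member of [W] separates itself from any other vertex, so both vertices may be taken outside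
   [W], hence outside [leaf_copies]. *)
have [aW|aW] := boolP (a \in W).
  by exists a; rewrite // distxx eq_sym dist_eq0 eq_sym.
have [bW|bW] := boolP (b \in W).
  by exists b; rewrite // distxx dist_eq0.
have outW d : d \notin W -> (exists u, d = inl u) \/ exists x, d = copy H c x.
  by move=> dW; apply: notin_leaf_copies; apply: contra dW; apply: (subsetP DW).
have [[u a_u]|[x a_x]] := outW a aW; have [[v b_v]|[y b_y]] := outW b bW; subst a b.
- have [|w wD neq] := @leaf_copies_separate_base u v.
    by apply: contra_neq ab => ->.
  by exists w; rewrite ?(subsetP DW).
- have [w wD neq] := leaf_copies_separate_copy u y.
  by exists w; rewrite ?(subsetP DW).
- have [w wD neq] := leaf_copies_separate_copy v x.
  by exists w; rewrite ?(subsetP DW) // eq_sym.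
- have [|z zW neq] := resW x y; first by apply: contra_neq ab => ->.
  by exists (copy H c z); [rewrite inE in zW | rewrite !dist_copy].
Qed.

Lemma diametral_dim_corona :
  diametral_dim (corona H) = #|diametral_set (corona H)| + metric_dim (H c).
Proof.
have card_union (W : {set H c}) :
    #|leaf_copies :|: copy H c @: W| = #|leaf_copies| + #|W|.
  rewrite cardsU (_ : _ :&: _ = set0) ?cards0 ?subn0.
    by rewrite card_imset //; apply: copy_inj.
  apply/setP=> a; rewrite in_set0; apply/negP; rewrite in_setI => /andP[aD].
  by case/imsetP=> x _ a_x; rewrite a_x leaf_copies_copy in aD.
rewrite diametral_set_corona; apply/eqP; rewrite eqn_leq; apply/andP; split.
  (* Upper bound: add a metric basis of [H c] to the leaf copies. *)
  have [W resW <-] := metric_dimP (H c).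
  rewrite -card_union; apply: diametral_dim_le.
  rewrite diametral_resolving_corona subsetUl /=.
  suff -> : copy H c @^-1: (leaf_copies :|: copy H c @: W) = W by [].
  apply/setP=> x; rewrite inE in_setU leaf_copies_copy /= mem_imset //.
  exact: copy_inj.
(* Lower bound: an optimal [W] contains the leaf copies and, disjoint from them, its trace on the
   copy at [c], which resolves [H c]. *)
have [W] := diametral_dimP (corona H).
rewrite diametral_resolving_corona => /andP[DW resW] <-.
apply: leq_trans (_ : #|leaf_copies| + #|copy H c @^-1: W| <= _).
  by rewrite leq_add2l metric_dim_le.
rewrite -card_union; apply/subset_leq_card/subUsetP; split=> //.
by apply/subsetP=> _ /imsetP[x xW ->]; rewrite inE in xW.
Qed.

End StarCorona.

(** The degree makes [v] adjacent to all other vertices. Were [v] a leaf, a third vertex would be a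
    leaf adjacent to it; hence [v] is the centre. *)
Lemma star_centerP (G : sgraph) (v : G) :
    3 <= #|G| -> is_star G -> deg v = #|G| - 1 ->
  (forall x, x != v -> adj v x) /\
  (forall x y, x != v -> y != v -> ~~ adj x y).
Proof.
move=> card_G [c [c_adj leaves]] deg_v.
have v_adj x : x != v -> adj v x.
  move=> xv; have: [set u | adj v u] == ~: [set v].
    rewrite eqEcard cardsC1 -subn1 -deg_v leqnn andbT.
    apply/subsetP=> u; rewrite !inE; apply: contraTneq => ->.
    by rewrite adj_irrefl.
  by move/eqP/setP/(_ x); rewrite !inE xv.
suff -> : v = c by [].
apply: contraTeq card_G => vc; rewrite -leqNgt.
have: [set: G] \subset [set v; c].
  apply/subsetP=> x _; rewrite !inE; apply: contraT; rewrite negb_or.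
  by case/andP=> /v_adj vx xc; have := leaves v x vc xc; rewrite vx.
by move/subset_leq_card; rewrite cardsT cards2 vc.
Qed.

Theorem theorem3p3 (n : nat) (n_ge3 : 3 <= n)
    (Sn : sgraph) (Sn_star : is_star Sn) (Sn_order : #|Sn| = n)
    (v1 : Sn) (deg_v1 : deg v1 = n - 1)
    (H : Sn -> sgraph)
    (H_star_or_complete : forall i : Sn, is_star (H i) \/ is_complete (H i)) :
  diametral_dim (corona H) = #|diametral_set (corona H)| + metric_dim (H v1).
Proof.
subst n; have [v1_adj leaves] := star_centerP n_ge3 Sn_star deg_v1.
apply: diametral_dim_corona => // [i|].
  by case: (H_star_or_complete i) => [/is_star_inhabited|/is_complete_inhabited].
case: (H_star_or_complete v1); first exact: star_diameter_le2.
exact: complete_diameter_le2.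
Qed.
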